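(* Let $p$ be an odd prime, $q=p^2$, $r\in\mathbb{N}^*$ and $A=(x^{q}-x)^{2r}\in\mathbb{F}_q[x]$. Then $A$ is bi-unitary perfect over $\mathbb{F}_q$ if and only if $r\in\Omega$, where $\Omega=\Omega_1\cup\Omega_2\cup\Omega_3\cup\Omega_4$ is the set of positive integers defined by $$\Omega_1=\{N : N \text{ and } 2N+2 \text{ both divide } p^2-1\},$$ $$\Omega_2=\{pN : N \text{ and } 2pN+2 \text{ both divide } p^2-1\},$$ $$\Omega_3=\{N : N\mid p^2-1 \text{ and } 2N+2=Mp \text{ for some } M\mid p^2-1\},$$ $$\Omega_4=\{N : N\mid p^2-1 \text{ and } 2N+2=Mp^2 \text{ for some } M\mid p^2-1\}$$ ($N$ and $M$ denoting positive integers).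
   Context: $\mathbb{N}^*$ is the set of positive integers; $\mathbb{F}_q$ is the field with $q$ elements. All divisors of polynomials are taken monic. For a monic polynomial $S$ over a finite field, a divisor $D$ of $S$ is unitary if $\gcd(D,S/D)=1$; $\gcd_u(S,T)$ denotes the greatest common unitary divisor of $S$ and $T$; a divisor $D$ of $S$ is bi-unitary if $\gcd_u(D,S/D)=1$. $\sigma^{**}(S)$ is the sum of all bi-unitary divisors of $S$, and $S$ is bi-unitary perfect if $\sigma^{**}(S)=S$. *)

(* Defs.v *)
From mathcomp Require Import all_boot all_order all_algebra.

Set Implicit Arguments.
Unset Strict Implicit.
Unset Printing Implicit Defensive.

Import GRing.Theory.
Local Open Scope ring_scope.

Definition unitary_divisor (F : finFieldType) (D S : {poly F}) : bool :=
  [&& D \is monic, D %| S & coprimep D (S %/ D)].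

(* Greatest means of greatest degree; for nonzero S and T there is exactly one
   such divisor. The type {poly_n F} of polynomials of size at most n is finite
   and contains all divisors of S when S is nonzero and n = size S. *)
Definition gcdu (F : finFieldType) (S T : {poly F}) : {poly F} :=
  [arg max_(D > npolyp (size S) 1 :> {poly_(size S) F}
              | unitary_divisor D S && unitary_divisor D T) size D]%N.

Definition biunitary_divisor (F : finFieldType) (D S : {poly F}) : bool :=
  [&& D \is monic, D %| S & gcdu D (S %/ D) == 1].

Definition sigma_biunitary (F : finFieldType) (S : {poly F}) : {poly F} :=
  \sum_(D : {poly_(size S) F} | biunitary_divisor D S) (D : {poly F}).

Definition biunitary_perfect (F : finFieldType) (S : {poly F}) : Prop :=
  sigma_biunitary S = S.

Local Open Scope nat_scope.

Definition Omega1 (p n : nat) : Prop :=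
  [/\ 0 < n, n %| p ^ 2 - 1 & 2 * n + 2 %| p ^ 2 - 1].

Definition Omega2 (p n : nat) : Prop :=
  exists N : nat,
    [/\ 0 < N, n = p * N, N %| p ^ 2 - 1 & 2 * p * N + 2 %| p ^ 2 - 1].

Definition Omega3 (p n : nat) : Prop :=
  [/\ 0 < n, n %| p ^ 2 - 1
    & exists M : nat, [/\ 0 < M, M %| p ^ 2 - 1 & 2 * n + 2 = M * p]].

Definition Omega4 (p n : nat) : Prop :=
  [/\ 0 < n, n %| p ^ 2 - 1
    & exists M : nat, [/\ 0 < M, M %| p ^ 2 - 1 & 2 * n + 2 = M * p ^ 2]].

Definition Omega (p n : nat) : Prop :=
  [\/ Omega1 p n, Omega2 p n, Omega3 p n | Omega4 p n].

(* Main.v *)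
(** A divisor prod (x - a)^(e_a) of A = prod (x - a)^(2r), a ranging over F_q, is
    bi-unitary iff no e_a equals r.  Hence sigma**(A) = prod_a f(x - a), where
    (x - 1) f = (x^(r+1) + 1)(x^r - 1) and deg f = 2r.  If this product is A, then f
    divides A and so splits over F_q; conversely, if f splits, translating each
    root by all a in F_q gives (x^q - x)^(2r).  So A is perfect iff x^(r+1) + 1 and
    x^r - 1 split over F_q, that is, iff N and 2M divide q - 1, where N and M are the
    prime-to-p parts of r and r + 1.  Size constraints bound the powers of p in r and
    r + 1, and this leaves exactly Omega. *)
Require Import Defs.
From mathcomp Require Import all_boot all_order all_algebra all_field.
From mathcomp Require Import ring zify.

Set Implicit Arguments.
Unset Strict Implicit.

Import GRing.Theory.
Local Open Scope ring_scope.

(** Association [%=] rather than equality absorbs leading coefficients; the zero polynomial does not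
    split. *)
Definition splits {F : fieldType} (g : {poly F}) : Prop :=
  exists s : seq F, g %= \prod_(b <- s) ('X - b%:P).

(** * Closure properties of split polynomials *)

Section Splits.
Variable F : fieldType.
Implicit Types g h : {poly F}.

Lemma splits_dvdp g h : g %| h -> splits h -> splits g.
Proof.
move=> gh [s hs].
have /dvdp_prod_XsubC[m gm] : g %| \prod_(b <- s) ('X - b%:P).
  by rewrite -(eqp_dvdr _ hs).
by exists (mask m s).
Qed.

Lemma splitsM g h : splits (g * h) <-> splits g /\ splits h.
Proof.
split=> [gh | [[s gs] [t ht]]].
  by split; apply: splits_dvdp gh; rewrite ?dvdp_mulIl ?dvdp_mulIr.
by exists (s ++ t); rewrite big_cat; apply: eqp_trans (eqp_mulr _ gs) (eqp_mull _ ht).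
Qed.

Lemma splits_prod_XsubC (s : seq F) : splits (\prod_(b <- s) ('X - b%:P)).
Proof. by exists s; rewrite eqpxx. Qed.

Lemma splits_XsubC (b : F) : splits ('X - b%:P).
Proof. by exists [:: b]; rewrite big_seq1 eqpxx. Qed.

Lemma splits1 : splits (1 : {poly F}).
Proof. by exists [::]; rewrite big_nil eqpxx. Qed.

Lemma splitsX g n : splits g -> splits (g ^+ n).
Proof.
by move=> sg; elim: n => [|n IHn]; [apply: splits1 | rewrite exprS; apply/splitsM].
Qed.

Lemma splitsX_gt0 g n : (0 < n)%N -> splits (g ^+ n) <-> splits g.
Proof.
move=> n_gt0; split; last exact: splitsX.
by apply: splits_dvdp; rewrite -[X in X %| _]expr1 dvdp_exp2l.
Qed.

Lemma splits_comp_scaleX g (c : F) : c != 0 -> splits g -> splits (g \Po (c *: 'X)).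
Proof.
move=> c0 [s /eqpP[[u v] /= /andP[u0 v0] guv]].
have -> : g = (v / u) *: \prod_(b <- s) ('X - b%:P).
  by rewrite mulrC -scalerA -guv scalerA mulVf // scale1r.
exists [seq b / c | b <- s]; rewrite comp_polyZ.
apply: eqp_trans (eqp_scale _ _) _; first by rewrite mulf_neq0 ?invr_eq0.
rewrite rmorph_prod big_map; elim: s {guv} => [|b s IHs]; first by rewrite !big_nil eqpxx.
rewrite !big_cons /= comp_polyB comp_polyX comp_polyC.
apply: eqp_trans (eqp_mull _ IHs) (eqp_mulr _ _).
have -> : c *: 'X - b%:P = c *: ('X - (b / c)%:P) :> {poly F}.
  by rewrite scalerBr scale_polyC mulrCA divff ?mulr1.
exact: eqp_scale.
Qed.

Lemma splits_monicE (D : {poly F}) :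
  D \is monic -> splits D -> exists s : seq F, D = \prod_(b <- s) ('X - b%:P).
Proof.
move=> mD [s Ds]; exists s; apply/eqP; rewrite -eqp_monic //.
by apply: monic_prod => b _; apply: monicXsubC.
Qed.

(* Scaling x by a root b of x^n + 1 turns x^n + 1 into -(x^n - 1), and
   x^(2n) - 1 is the product of the two. *)
Lemma splits_Xn_add1 (n : nat) : (0 < n)%N ->
  splits ('X^n + 1 : {poly F}) <-> splits ('X^(2 * n) - 1 : {poly F}).
Proof.
move=> n_gt0.
have -> : 'X^(2 * n) - 1 = ('X^n - 1) * ('X^n + 1) :> {poly F}.
  by rewrite mulnC exprM subr_sqr_1.
split; last by case/splitsM.
move=> sp; apply/splitsM; split=> //.
case: (sp) => s /eqP; case: s => [|b s].
  rewrite big_nil => /eqP/eqp_size; rewrite size_polyDl ?size_polyXn ?size_poly1 //.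
  by case: (n) n_gt0.
rewrite big_cons => /eqP e.
have : root ('X^n + 1 : {poly F}) b by rewrite (eqp_root e) rootM root_XsubC eqxx.
rewrite /root !hornerE addr_eq0 => /eqP bn.
have b0 : b != 0.
  apply/eqP=> b0; move: bn; rewrite b0 expr0n eqn0Ngt n_gt0 /= => /eqP.
  by rewrite eq_sym oppr_eq0 oner_eq0.
have := splits_comp_scaleX b0 sp.
rewrite comp_polyD comp_Xn_poly exprZn bn scaleN1r [X in _ + X]rmorph1.
apply: splits_dvdp; rewrite [X in _ %| X]addrC.
by rewrite -[X in _ %| X]opprB -[X in _ %| X]scaleN1r dvdpZr ?oppr_eq0 ?oner_eq0.
Qed.

End Splits.

(** * Splitting of X^n - 1 over a finite field *)

Section FiniteField.
Variable F : finFieldType.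

Lemma splits_Xq_sub_X : splits ('X^#|F| - 'X : {poly F}).
Proof. by rewrite finField_genPoly -big_enum; apply: splits_prod_XsubC. Qed.

(** As n is nonzero in F, X^n - 1 is separable; if it splits it has n distinct roots, among them a
    primitive n-th root of unity z, and z^q = z gives the divisibility. Conversely X^n - 1 divides
    X^(q-1) - 1, hence X^q - X. *)
Lemma splits_Xn_sub1 (n : nat) : n%:R != 0 :> F ->
  splits ('X^n - 1 : {poly F}) <-> (n %| #|F| - 1)%N.
Proof.
move=> nF; have n_gt0 : (0 < n)%N by case: (n) nF => //; rewrite eqxx.
have F_gt1 := finNzRing_gt1 F; split=> [sp | /dvdnP[k Fk]].
  have [s es] := splits_monicE (monicXnsubC 1 n_gt0) sp.
  have us : uniq s by rewrite -separable_prod_XsubC -es separable_Xn_sub_1.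
  have szs : size s = n.
    by apply: succn_inj; rewrite -(size_prod_XsubC s id) -es size_XnsubC.
  have rs : all n.-unity_root s.
    by apply/allP=> x; rewrite -root_prod_XsubC -es.
  have /hasP[z _ zn] : has n.-primitive_root s by rewrite cyclic.has_prim_root // szs.
  have z0 : z != 0.
    apply/eqP=> z0; have := prim_expr_order zn; rewrite z0 expr0n gtn_eqF //=.
    by move/eqP; rewrite eq_sym oner_eq0.
  rewrite (prim_order_dvd zn) -(inj_eq (mulfI z0)) -exprS mulr1 subn1 prednK ?expf_card //.
  exact: ltnW.
apply: (@splits_dvdp _ _ ('X^(#|F| - 1) - 1)).
  by rewrite Fk mulnC exprM [X in _ %| X]subrX1 dvdp_mulIl.
apply: splits_dvdp splits_Xq_sub_X.
have -> : 'X^#|F| - 'X = 'X * ('X^(#|F| - 1) - 1) :> {poly F}.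
  by rewrite mulrBr -exprS subn1 prednK ?mulr1 // ltnW.
by rewrite dvdp_mull.
Qed.

End FiniteField.

(** * Unitary and bi-unitary divisors through root multiplicities *)

Section BiunitaryDivisors.
Variable F : finFieldType.
Implicit Types S D U : {poly F}.

Lemma monic_splits_mupE D :
  D \is monic -> splits D -> D = \prod_a ('X - a%:P) ^+ mup a D.
Proof.
move=> mD /(splits_monicE mD)[s ->] {mD D}.
under [RHS]eq_bigr do rewrite mu_prod_XsubC.
elim: s => [|b s IHs]; first by rewrite big_nil big1.
rewrite big_cons {}IHs; under [RHS]eq_bigr do rewrite exprD.
rewrite big_split /=; congr (_ * _); rewrite (bigD1 b) //= eqxx expr1.
rewrite big1 ?mulr1 // => a ab; by rewrite eq_sym (negbTE ab).
Qed.

Lemma mup_prodX (e : F -> nat) (a : F) : mup a (\prod_b ('X - b%:P) ^+ e b) = e a.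
Proof.
rewrite (bigD1 a) //= mupMl ?mup_XsubCX ?eqxx //.
rewrite /root horner_prod; apply/prodf_neq0 => b ba.
by rewrite horner_exp !hornerE expf_neq0 // subr_eq0 eq_sym.
Qed.

Lemma mup_mul_divp U S a : S != 0 -> U %| S -> mup a S = (mup a U + mup a (S %/ U))%N.
Proof.
move=> S0 US; have SE := divpK US.
have : S %/ U * U != 0 by rewrite SE.
by rewrite mulf_eq0 negb_or => /andP[Q0 U0]; rewrite -{1}SE mupM // addnC.
Qed.

(** Coprimality of [U] and [S %/ U] leaves [a] as a root of at most one of them. *)
Lemma mup_unitary U S a : S != 0 -> unitary_divisor U S ->
  (mup a U == 0)%N || (mup a U == mup a S).
Proof.
move=> S0 /and3P[mU US cop]; have U0 := monic_neq0 mU.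
have SE := mup_mul_divp a S0 US.
have Q0 : S %/ U != 0 by apply: contraNneq S0 => Q0; rewrite -(divpK US) Q0 mul0r.
case: posnP => //= Ua; rewrite SE -[X in X == _]addn0 eqn_add2l eq_sym.
have Ur : root U a by rewrite -dvdp_XsubCl XsubC_dvd.
have := coprimep_root cop Ur; rewrite -/(root _ _) -dvdp_XsubCl XsubC_dvd //.
by rewrite -eqn0Ngt.
Qed.

Lemma unitary_XsubCX_mup S a : S != 0 -> unitary_divisor (('X - a%:P) ^+ mup a S) S.
Proof.
move=> S0; set U := _ ^+ _.
have US : U %| S by rewrite -mup_geq.
have Q0 : S %/ U != 0 by apply: contraNneq S0 => Q0; rewrite -(divpK US) Q0 mul0r.
apply/and3P; split=> //; first by rewrite monic_exp ?monicXsubC.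
rewrite coprimep_sym coprimep_expr // coprimep_XsubC -dvdp_XsubCl XsubC_dvd //.
rewrite -eqn0Ngt; have := mup_mul_divp a S0 US.
by rewrite mup_XsubCX eqxx => /eqP; rewrite -[X in X == _]addn0 eqn_add2l eq_sym.
Qed.

(** The polynomial 1 is always a common unitary divisor, so the default of [arg max] is admissible;
    if the largest degree is 0, every common unitary divisor is a monic constant. *)
Lemma gcdu_eq1P S T : S != 0 ->
  reflect (forall U, unitary_divisor U S -> unitary_divisor U T -> U = 1) (gcdu S T == 1).
Proof.
move=> S0; have szS : (0 < size S)%N by rewrite size_poly_gt0.
have one_unitary V : unitary_divisor 1 V.
  by rewrite /unitary_divisor monic1 dvd1p coprime1p.
have E1 : npolyp (size S) 1 = 1 :> {poly F} by rewrite npolypK ?size_poly1.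
rewrite /gcdu; case: arg_maxnP => [|/= D /andP[DS DT] maxD]; first by rewrite E1 !one_unitary.
apply: (iffP eqP) => [D1 U US UT | H]; last exact: H.
have [mU UdS _] := and3P US.
have szU : (size U <= size S)%N by apply: dvdp_leq.
have := maxD (npolyp (size S) U); rewrite npolypK // US UT => /(_ isT).
rewrite D1 size_poly1 => /size1_polyC UC; move: mU; rewrite UC monicE lead_coefC => /eqP->.
by rewrite polyC1.
Qed.

(** If [a] has equal positive multiplicities in [D] and [S %/ D], that power of ['X - a%:P] is a
    common unitary divisor. Conversely, a root of a common unitary divisor carries its full
    multiplicity in both. *)
Lemma biunitary_splitsP D S : S != 0 -> splits S -> D \is monic -> D %| S ->
  reflect (forall a, mup a D = mup a (S %/ D) -> mup a D = 0%N) (biunitary_divisor D S).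
Proof.
move=> S0 spS mD DS; rewrite /biunitary_divisor mD DS /=; have D0 := monic_neq0 mD.
have Q0 : S %/ D != 0 by apply: contraNneq S0 => Q0; rewrite -(divpK DS) Q0 mul0r.
apply: (iffP (gcdu_eq1P _ D0)) => [H a Da | H U UD UQ].
  have := H _ (unitary_XsubCX_mup a D0).
  rewrite {1}Da => /(_ (unitary_XsubCX_mup a Q0))/(congr1 (mup a)).
  rewrite mup_XsubCX eqxx => ->.
  by apply: mupNroot; rewrite rootC oner_eq0.
have [mU UdD _] := and3P UD.
rewrite (monic_splits_mupE mU (splits_dvdp (dvdp_trans UdD DS) spS)) big1 // => a _.
have := mup_unitary a D0 UD; have := mup_unitary a Q0 UQ.
by case: eqP => [->//|_ /= /eqP EQ /eqP ED]; rewrite ED H // -ED EQ.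
Qed.

End BiunitaryDivisors.

(** * The bi-unitary divisor sum as a product over the field *)

Section SigmaBiunitary.
Variables (F : finFieldType) (r : nat).
Hypothesis r_gt0 : (0 < r)%N.

(** This is (X^q - X)^(2r) in factored form, with q = [#|F|]. *)
Let A : {poly F} := \prod_a ('X - a%:P) ^+ (2 * r).

Let prodX_monic (e : F -> nat) : \prod_a ('X - a%:P) ^+ e a \is monic.
Proof. by apply: monic_prod => a _; rewrite monic_exp ?monicXsubC. Qed.

Let A0 : A != 0. Proof. by rewrite monic_neq0 ?prodX_monic. Qed.

Let splitsA : splits A.
Proof.
rewrite /A prodrXl; apply: splitsX; rewrite -big_enum; exact: splits_prod_XsubC.
Qed.

Let A_split (e : F -> nat) : (forall a, e a <= 2 * r)%N ->
  A = \prod_a ('X - a%:P) ^+ (2 * r - e a) * \prod_a ('X - a%:P) ^+ e a.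
Proof.
by move=> le_e; rewrite -big_split; apply: eq_bigr => a _; rewrite /= -exprD subnK.
Qed.

(** The complementary exponents [e a] and [2 * r - e a] agree only at r, which is positive. *)
Lemma biunitary_prodX (e : F -> nat) : (forall a, e a <= 2 * r)%N ->
  biunitary_divisor (\prod_a ('X - a%:P) ^+ e a) A = [forall a, e a != r].
Proof.
move=> le_e; set D := \prod_a _ ^+ e _.
have AE := A_split le_e; rewrite -/D in AE.
have D0 : D != 0 by rewrite monic_neq0 ?prodX_monic.
have DA : D %| A by rewrite AE dvdp_mulIr.
apply/biunitary_splitsP/forallP => // [|H a|H a]; first exact: prodX_monic.
  apply/eqP => ea; have := H a; rewrite AE mulpK // !mup_prodX ea => H0.
  by move: r_gt0; rewrite H0 //; lia.
by rewrite AE mulpK // !mup_prodX => ea; have := H a; have := le_e a; lia.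
Qed.

(** Monic divisors of [A] correspond to exponent functions, and bi-unitarity constrains each
    exponent separately, so the sum factors by distributivity. *)
Lemma sigma_biunitary_prod :
  sigma_biunitary A = \prod_(a : F) \sum_(k < (2 * r).+1 | k != r :> nat) ('X - a%:P) ^+ k.
Proof.
rewrite bigA_distr_big /sigma_biunitary /=.
pose h (e : {ffun F -> 'I_(2 * r).+1}) := npolyp (size A) (\prod_a ('X - a%:P) ^+ e a).
have le_e (e : {ffun F -> 'I_(2 * r).+1}) a : (e a <= 2 * r)%N by rewrite -ltnS.
have hE e : h e = \prod_a ('X - a%:P) ^+ e a :> {poly F}.
  by rewrite npolypK // dvdp_leq // (A_split (le_e e)) dvdp_mulIr.
rewrite (reindex_onto h (fun D => [ffun a => inord (mup a (D : {poly F}))])) /=.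
  apply: eq_big => [e|e _]; last exact: hE.
  rewrite hE biunitary_prodX //.
  have -> : [ffun a => inord (mup a (\prod_b ('X - b%:P) ^+ e b))] = e.
    by apply/ffunP => a; rewrite ffunE mup_prodX inord_val.
  by rewrite eqxx andbT; apply/forallP/ffun_onP.
move=> D /and3P[mD DA _]; apply: val_inj; rewrite /= hE.
rewrite [RHS]monic_splits_mupE //; last exact: splits_dvdp DA splitsA.
(* The multiplicity of [a] in [D] is at most its multiplicity 2r in [A], so [inord] preserves it. *)
apply: eq_bigr => a _; rewrite ffunE inordK // ltnS.
rewrite -[X in (_ <= X)%N](mup_prodX (fun=> 2 * r)%N a) -/A.
by rewrite mup_geq // (dvdp_trans _ DA) // -mup_geq // monic_neq0.
Qed.

End SigmaBiunitary.

(** * The factor f attached to one root *)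

Section LocalFactor.
Variables (F : fieldType) (r : nat).

Definition local_sigma : {poly F} := \sum_(k < (2 * r).+1 | k != r :> nat) 'X^k.

(** The full geometric sum yields X^(2r+1) - 1; subtracting X^r (X - 1) for the missing term leaves
    an expression that factors. *)
Lemma local_sigma_mul_XsubC1 : local_sigma * ('X - 1) = ('X^(r.+1) + 1) * ('X^r - 1).
Proof.
have -> : local_sigma = \sum_(k < (2 * r).+1) 'X^k - 'X^r.
  have r_lt : (r < (2 * r).+1)%N by lia.
  rewrite (bigD1 (Ordinal r_lt)) //= addrC addrK; exact: eq_bigl.
rewrite mulrBl [X in X - _]mulrC -subrX1 mul2n -addnn !exprS exprD; ring.
Qed.

Hypothesis r_gt0 : (0 < r)%N.

Let XnD1E n : 'X^n + 1 = 'X^n - (-1)%:P :> {poly F}.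
Proof. by rewrite polyCN opprK. Qed.

Lemma local_sigma_monic : local_sigma \is monic.
Proof.
have : lead_coef (local_sigma * ('X - 1)) = lead_coef (('X^(r.+1) + 1) * ('X^r - 1) : {poly F}).
  by rewrite local_sigma_mul_XsubC1.
rewrite !lead_coefM XnD1E -!polyC1 !(monicP (monicXsubC _)) !(monicP (monicXnsubC _ _)) //.
by rewrite !mulr1 => /eqP.
Qed.

Lemma size_local_sigma : size local_sigma = (2 * r).+1.
Proof.
have : size (local_sigma * ('X - 1)) = size (('X^(r.+1) + 1) * ('X^r - 1) : {poly F}).
  by rewrite local_sigma_mul_XsubC1.
rewrite XnD1E -!polyC1 !size_Mmonic ?monic_neq0 ?local_sigma_monic ?monicXsubC ?monicXnsubC //.
rewrite size_XsubC !size_XnsubC //; lia.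
Qed.

Lemma splits_local_sigma :
  splits local_sigma <->
  splits ('X^(r.+1) + 1 : {poly F}) /\ splits ('X^r - 1 : {poly F}).
Proof.
rewrite -splitsM -local_sigma_mul_XsubC1 splitsM; split=> [|[]] //; split=> //.
by rewrite -polyC1; apply: splits_XsubC.
Qed.

End LocalFactor.

(** * Perfection as splitting, and splitting in characteristic p *)

Section Perfect.
Variable F : finFieldType.

(** For each root b of [g], the translates X - a - b run over all linear factors as a does, so every
    root contributes one full product. *)
Lemma prod_comp_translate (g : {poly F}) : g \is monic -> splits g ->
  \prod_a (g \Po ('X - a%:P)) = (\prod_a ('X - a%:P)) ^+ (size g).-1.
Proof.
move=> mg /(splits_monicE mg)[s ->] {g mg}; rewrite size_prod_XsubC /=.
under eq_bigr do rewrite rmorph_prod.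
rewrite exchange_big /=; elim: s => [|b s IHs]; first by rewrite big_nil.
rewrite big_cons exprS IHs; congr (_ * _).
rewrite [RHS](reindex_inj (addIr b)); apply: eq_bigr => a _.
by rewrite comp_polyB comp_polyX comp_polyC polyCD opprD addrA.
Qed.

Lemma biunitary_perfect_splits (r : nat) : (0 < r)%N ->
  biunitary_perfect (('X^#|F| - 'X) ^+ (2 * r) : {poly F}) <->
  splits (local_sigma F r).
Proof.
move=> r_gt0; rewrite /biunitary_perfect finField_genPoly -prodrXl sigma_biunitary_prod //.
have -> : \prod_(a : F) \sum_(k < (2 * r).+1 | k != r :> nat) ('X - a%:P) ^+ k
          = \prod_a (local_sigma F r \Po ('X - a%:P)).
  apply: eq_bigr => a _; rewrite rmorph_sum; apply: eq_bigr => k _.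
  by rewrite /= comp_Xn_poly.
rewrite prodrXl; split=> [E | sp]; last first.
  by rewrite prod_comp_translate ?local_sigma_monic // size_local_sigma.
(* The factor at a = 0 is [local_sigma] itself, so it divides a split polynomial. *)
apply: (@splits_dvdp _ _ ((\prod_a ('X - a%:P)) ^+ (2 * r))).
  by rewrite -E (bigD1 0) //= subr0 comp_polyXr dvdp_mulIl.
by apply: splitsX; rewrite -big_enum; apply: splits_prod_XsubC.
Qed.

Variable p : nat.
Hypothesis pF : p \in [pchar F].

Let exprD1_pchar (g : {poly F}) k : g ^+ (p ^ k) + 1 = (g + 1) ^+ (p ^ k).
Proof.
rewrite exprDn_pchar ?expr1n // (eq_pnat _ (pchar_poly F)) pnatX.
by rewrite pnatE ?pF // (pcharf_prime pF).
Qed.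

Let natr_neq0_coprime n : coprime p n -> n%:R != 0 :> F.
Proof. by rewrite -(dvdn_pcharf pF) prime_coprime ?(pcharf_prime pF). Qed.

Let p_gt0 k : (0 < p ^ k)%N.
Proof. by rewrite expn_gt0 prime_gt0 ?(pcharf_prime pF). Qed.

(** By Frobenius the polynomial is a p^k-th power of X^n - 1, so only the prime-to-p part of the
    exponent matters. *)
Lemma splits_Xn_sub1_pchar n k : coprime p n ->
  splits ('X^(n * p ^ k) - 1 : {poly F}) <-> (n %| #|F| - 1)%N.
Proof.
move=> pn; have -> : 'X^(n * p ^ k) - 1 = ('X^n - 1) ^+ (p ^ k) :> {poly F}.
  by apply: (addIr 1); rewrite exprD1_pchar !subrK exprM.
by rewrite splitsX_gt0 // splits_Xn_sub1 // natr_neq0_coprime.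
Qed.

Lemma splits_Xn_add1_pchar n k : odd p -> (0 < n)%N -> coprime p n ->
  splits ('X^(n * p ^ k) + 1 : {poly F}) <-> (2 * n %| #|F| - 1)%N.
Proof.
move=> p_odd n_gt0 pn.
rewrite exprM exprD1_pchar splitsX_gt0 // splits_Xn_add1 // splits_Xn_sub1 //.
by rewrite natr_neq0_coprime // coprimeMr pn coprimen2 p_odd.
Qed.

End Perfect.

(** * Arithmetic of the set Omega *)

(** The sets [Omega1] to [Omega4] are the cases (k, l) = (0, 0), (1, 0), (0, 1), (0, 2); size bounds
    and the coprimality of r and r + 1 exclude all others. *)
Lemma OmegaP (p r : nat) : prime p -> odd p -> (0 < r)%N ->
  Omega p r <-> exists N k M l : nat,
    [/\ r = N * p ^ k, r.+1 = M * p ^ l, N %| p ^ 2 - 1 & 2 * M %| p ^ 2 - 1]%N.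
Proof.
move=> p_pr p_odd r_gt0; have p_gt1 := prime_gt1 p_pr; split.
  case=> [[_ rd Md] | [N [N0 -> Nd Md]] | [_ rd [M [M0 Md E]]] | [_ rd [M [M0 Md E]]]].
  - exists r, 0%N, r.+1, 0%N; split; rewrite ?expn0 ?muln1 //.
    by rewrite (_ : 2 * r.+1 = 2 * r + 2)%N //; lia.
  - exists N, 1%N, (p * N).+1, 0%N; split; rewrite ?expn0 ?expn1 ?muln1 1?mulnC //.
    by rewrite (_ : (p * N).+1 * 2 = 2 * p * N + 2)%N //; lia.
  (* The [M] of [Omega3] is even because p is odd, and its half is the witness. *)
  - have Mev : M = (2 * M./2)%N.
      have : ~~ odd (M * p) by rewrite -E; lia.
      by rewrite oddM p_odd andbT; lia.
    exists r, 0%N, M./2, 1%N; split; rewrite -?Mev ?muln1 //; lia.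
  - have Mev : M = (2 * M./2)%N.
      have : ~~ odd (M * p ^ 2) by rewrite -E; lia.
      by rewrite oddM oddX p_odd andbT; lia.
    exists r, 0%N, M./2, 2; split; rewrite -?Mev ?muln1 //; lia.
move=> [N [k [M [l [rE r1E Nd Md]]]]].
have N_gt0 : (0 < N)%N by case: (N) rE r_gt0 => // ->.
have M_gt0 : (0 < M)%N by case: (M) r1E.
have p2 : (4 <= p ^ 2)%N by rewrite (@leq_exp2r 2 p 2).
have N_le : (N <= p ^ 2 - 1)%N by apply: dvdn_leq => //; lia.
have M_le : (2 * M <= p ^ 2 - 1)%N by apply: dvdn_leq => //; lia.
case: k => [|k] in rE *; case: l => [|l] in r1E *.
- rewrite !muln1 in rE r1E; apply: Or41; split; rewrite ?rE //.
  by rewrite (_ : 2 * N + 2 = 2 * M)%N //; lia.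
- rewrite muln1 in rE.
  (* Here r = N is at most p^2 - 1, so p^(l+1) <= r + 1 <= p^2. *)
  have l_le : (l < 2)%N.
    rewrite -ltnS -(ltn_exp2l _ _ p_gt1); apply: (@leq_ltn_trans r.+1).
      by rewrite r1E leq_pmull.
    rewrite rE; apply: (@leq_ltn_trans (p ^ 2)); first by lia.
    by rewrite ltn_exp2l.
  case: l l_le r1E => [|[|l]] // _ r1E.
  + apply: Or43; split; rewrite ?rE //; exists (2 * M)%N; split=> //; lia.
  + apply: Or44; split; rewrite ?rE //; exists (2 * M)%N; split=> //; lia.
- rewrite muln1 in r1E.
  (* Here r + 1 = M and 2M <= p^2 - 1, so p^(k+1) <= r < p^2. *)
  have k_le : (k < 1)%N.
    rewrite -ltnS -(ltn_exp2l _ _ p_gt1); apply: (@leq_ltn_trans r); last by lia.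
    by rewrite rE leq_pmull.
  case: k k_le rE => // _ rE.
  apply: Or42; exists N; rewrite expn1 in rE; split=> //; first by lia.
  by rewrite (_ : 2 * p * N + 2 = 2 * M)%N //; lia.
- have : (p %| r.+1 - r)%N.
    by rewrite dvdn_sub // ?r1E ?rE expnS mulnCA dvdn_mulr.
  by rewrite subSnn dvdn1; lia.
Qed.

Theorem theorem4p1 (p q r : nat) (F : finFieldType) (p_prime : prime p)
    (p_odd : odd p) (q_eq : q = (p ^ 2)%N) (F_card : #|F| = q)
    (r_gt0 : (0 < r)%N) :
  biunitary_perfect (('X^q - 'X) ^+ (2 * r) : {poly F}) <-> Omega p r.
Proof.
have pF : p \in [pchar F] by apply: (@card_finPcharP _ _ 2); rewrite ?F_card.
have cop n : (n %| p ^ 2 - 1)%N -> coprime p n.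
  (* The consecutive integers p^2 - 1 and p^2 are coprime. *)
  move=> n_dvd; apply: coprime_dvdr n_dvd _.
  by rewrite -(coprime_pexpl _ _ (ltn0Sn 1)) subn1 coprimenP // expn_gt0 prime_gt0.
rewrite -{1}F_card biunitary_perfect_splits // splits_local_sigma // OmegaP //.
rewrite -q_eq -F_card in cop *; split=> [[]|[N [k [M [l [rE r1E Nd Md]]]]]].
  (* The witnesses N and M are the prime-to-p parts of r and r + 1, and k and l the p-adic
     valuations. *)
  have [N pN rE] := pfactor_coprime p_prime r_gt0.
  have [M pM r1E] := pfactor_coprime p_prime (ltn0Sn r).
  have M_gt0 : (0 < M)%N by case: (M) r1E.
  rewrite [X in 'X^X + 1]r1E [X in 'X^X - 1]rE splits_Xn_sub1_pchar //.
  rewrite splits_Xn_add1_pchar // => Md Nd.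
  by exists N, (logn p r), M, (logn p r.+1).
have M_gt0 : (0 < M)%N by case: (M) r1E.
rewrite [X in 'X^X + 1]r1E [X in 'X^X - 1]rE splits_Xn_sub1_pchar ?cop // splits_Xn_add1_pchar //.
by apply: coprime_dvdr (cop _ Md); rewrite dvdn_mull.
Qed.
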